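(* Let $(M,K)$ be a Cartan space. Then the $1$-indicatrix bundle $I^*M(1)$, equipped with $(\varphi,\omega,\xi,\bar G)$, is a contact (metric) manifold.
   Context: Let $M$ be a real $n$-dimensional smooth manifold with cotangent bundle $\pi^*:T^*M\to M$, local coordinates $(x^i)$ on $M$, induced coordinates $(x^i,p_i)$ on $T^*M$, and $\partial^i:=\partial/\partial p_i$; repeated indices are summed. A Cartan space is a pair $(M,K)$, where $K=K(x,p)$ is a real positive function on $T^*M$, smooth off the zero section and continuous on it, positively $1$-homogeneous in $p$, such that $g^{ij}(x,p)=\frac12\partial^i\partial^jK^2$ is positive definite off the zero section. All objects below live on $T^*M$ with the zero section removed. Let $(g_{ij})=(g^{ij})^{-1}$ and $\{f,h\}=\frac{\partial f}{\partial p_i}\frac{\partial h}{\partial x^i}-\frac{\partial h}{\partial p_i}\frac{\partial f}{\partial x^i}$. The canonical nonlinear connection is $$N_{ij}=\tfrac14\{g_{ij},K^2\}-\tfrac14\Big(g_{ik}\tfrac{\partial^2K^2}{\partial p_k\partial x^j}+g_{jk}\tfrac{\partial^2K^2}{\partial p_k\partial x^i}\Big).$$ Set $\frac{\delta}{\delta x^i}=\frac{\partial}{\partial x^i}+N_{ij}\partial^j$ and $\delta p_i=dp_i-N_{ij}dx^j$. The Sasaki-type metric is $G=g_{ij}dx^i\otimes dx^j+g^{ij}\delta p_i\otimes\delta p_j$, and the compatible almost complex structure $J$ is given by $J\partial^i=g^{ij}\frac{\delta}{\delta x^j}$, $J\frac{\delta}{\delta x^i}=-g_{ij}\partial^j$.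 Let $C^*=p_i\partial^i$, $\xi=JC^*=p_ig^{ij}\frac{\delta}{\delta x^j}$, and let $\omega=p_idx^i$ be the Liouville $1$-form (the $G$-dual of $\xi$). Let $I^*M(1)=\{(x,p)\in T^*M:K(x,p)=1\}$, whose tangent spaces are the $G$-orthogonal complements of $C^*$; $\xi$ is tangent to it. Let $\bar G$ be the restriction of $G$ to $I^*M(1)$, and restrict $\omega,\xi$ to $I^*M(1)$. Let $D=\{X: G(X,\xi)=G(X,C^* )=0\}$ and define the $(1,1)$-tensor field $\varphi$ on $I^*M(1)$ by $\varphi=-J$ on $D$ and $\varphi(\xi)=0$. A manifold with a $(1,1)$-tensor field $\varphi$, a $1$-form $\omega$, a vector field $\xi$ and a Riemannian metric $\bar G$ is here called a contact (metric) manifold if $\omega(\xi)=1$, $\omega\circ\varphi=0$, $\varphi(\xi)=0$, $\varphi^2=-I+\xi\otimes\omega$, $\bar G(\varphi X,\varphi Y)=\bar G(X,Y)-\omega(X)\omega(Y)$, and $d\omega(X,Y)=\bar G(X,\varphi Y)$ for all tangent vector fields $X,Y$, where $d\omega(X,Y)=X\omega(Y)-Y\omega(X)-\omega([X,Y])$. *)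

(* Defs.v *)
From mathcomp Require Import all_boot all_order all_algebra.
From mathcomp Require Import all_classical all_reals all_analysis.

Set Implicit Arguments.
Unset Strict Implicit.
Unset Printing Implicit Defensive.

Import Order.TTheory GRing.Theory Num.Theory.
Import numFieldNormedType.Exports.

Local Open Scope classical_set_scope.
Local Open Scope ring_scope.

(* [Ck k O f] is only meaningful for [O] open. *)
Fixpoint Ck (R : realType) (V W : normedModType R) (k : nat) (O : set V)
    (f : V -> W) : Prop :=
  match k with
  | 0%N => forall x, O x -> {for x, continuous f}
  | k'.+1 => (forall x, O x -> differentiable f x) /\
             forall v : V, Ck k' O (fun x => 'D_v f x)
  end.

Definition smooth_on (R : realType) (V W : normedModType R) (O : set V)
    (f : V -> W) : Prop :=
  forall k, Ck k O f.

(* [chart_to] and [chart_from] are total functions; only their restrictions to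
   [chart_dom] and [chart_img] are meaningful. *)
Record chart (R : realType) (n : nat) (M : topologicalType) := Chart {
  chart_dom : set M;
  chart_img : set 'rV[R]_n;
  chart_to : M -> 'rV[R]_n;
  chart_from : 'rV[R]_n -> M;
  chart_open_dom : open chart_dom;
  chart_open_img : open chart_img;
  chart_toP : forall x, chart_dom x -> chart_img (chart_to x);
  chart_fromP : forall y, chart_img y -> chart_dom (chart_from y);
  chart_toK : forall x, chart_dom x -> chart_from (chart_to x) = x;
  chart_fromK : forall y, chart_img y -> chart_to (chart_from y) = y;
  chart_to_cont : forall x, chart_dom x -> {for x, continuous chart_to};
  chart_from_cont : forall y, chart_img y -> {for y, continuous chart_from} }.

Record smooth_manifold (R : realType) (n : nat) := SmoothManifold {
  mcarrier :> topologicalType;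
  mhausdorff : hausdorff_space mcarrier;
  msecond_countable : @second_countable mcarrier;
  atlas : set (chart R n mcarrier);
  atlas_cover : forall x : mcarrier, exists2 a, atlas a & chart_dom a x;
  atlas_smooth : forall a b, atlas a -> atlas b ->
    smooth_on [set y | chart_img a y /\ chart_dom b (chart_from a y)]
              (chart_to b \o chart_from a) }.

(* Row [i], column [j]: the partial derivative at [x] of the [i]-th coordinate
   of the chart [a] with respect to the [j]-th coordinate of the chart [b]. *)
Definition dcoord (R : realType) (n : nat) (M : smooth_manifold R n)
    (a b : chart R n M) (x : M) : 'M[R]_n :=
  \matrix_(i, j)
    ('D_(delta_mx 0 j) (chart_to a \o chart_from b) (chart_to b x)) 0 i.

(* A covector at [base] is the family of its component rows in the charts
   around [base], related by the classical transformation law; components in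
   the other charts are set to 0 so that equality is equality of covectors. *)
Record cotangent_bundle (R : realType) (n : nat) (M : smooth_manifold R n) :=
  Covector {
  base : M;
  comp : chart R n M -> 'rV[R]_n;
  comp_law : forall a b, atlas a -> atlas b ->
    chart_dom a base -> chart_dom b base -> comp b = comp a *m dcoord a b base;
  comp_out : forall a, ~ (atlas a /\ chart_dom a base) -> comp a = 0 }.

(* [(x, p)]: positions and momenta, or components of a tangent vector
   [v.1^i d/dx^i + v.2_i d/dp_i]. *)
Notation phase R n := ('rV[R]_n * 'rV[R]_n)%type.

Definition coord (R : realType) (n : nat) (M : smooth_manifold R n)
    (a : chart R n M) (u : cotangent_bundle M) : phase R n :=
  (chart_to a (base u), comp u a).

Definition uncoord_comp (R : realType) (n : nat) (M : smooth_manifold R n)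
    (a : chart R n M) (z : phase R n) (b : chart R n M) : 'rV[R]_n :=
  let x := chart_from a z.1 in
  if `[< [/\ atlas a, chart_img a z.1, atlas b & chart_dom b x] >]
  then z.2 *m dcoord a b x else 0.

Lemma atlas_diff (R : realType) (n : nat) (M : smooth_manifold R n)
    (a b : chart R n M) (x : M) :
  atlas a -> atlas b -> chart_dom a x -> chart_dom b x ->
  differentiable (chart_to a \o chart_from b) (chart_to b x).
Proof.
move=> aa ab ax bx; have [+ _] := atlas_smooth ab aa 1%N.
by apply=> /=; split; [exact: chart_toP | rewrite chart_toK].
Qed.

Lemma linear_row (R : realType) (n : nat) (D : {linear 'rV[R]_n -> 'rV[R]_n})
    (w : 'rV[R]_n) (i : 'I_n) :
  D w 0 i = \sum_k D (delta_mx 0 k) 0 i * w 0 k.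
Proof.
rewrite {1}(row_sum_delta w) linear_sum summxE; apply: eq_bigr => k _.
by rewrite linearZ mxE mulrC.
Qed.

Lemma chain_row (R : realType) (n : nat) (f g : 'rV[R]_n -> 'rV[R]_n)
    (y e : 'rV[R]_n) (i : 'I_n) :
  differentiable g y -> differentiable f (g y) ->
  ('D_e (f \o g) y) 0 i =
  \sum_k ('D_(delta_mx 0 k) f (g y)) 0 i * ('D_e g y) 0 k.
Proof.
move=> dg df; have -> : 'D_e g y = 'd g y e by exact: deriveE.
have -> : 'D_e (f \o g) y = 'd f (g y) ('d g y e).
  have h := congr1 (fun u : 'rV[R]_n -> 'rV[R]_n => u e) (diff_comp dg df).
  exact: etrans (deriveE e (differentiable_comp dg df)) h.
rewrite (linear_row ('d f (g y))); apply: eq_bigr => k _; congr (_ * _).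
by rewrite (deriveE (delta_mx 0 k) df).
Qed.

Lemma dcoord_comp (R : realType) (n : nat) (M : smooth_manifold R n)
    (a b c : chart R n M) (x : M) :
  atlas a -> atlas b -> atlas c ->
  chart_dom a x -> chart_dom b x -> chart_dom c x ->
  dcoord a c x = dcoord a b x *m dcoord b c x.
Proof.
move=> aa ab ac ax bx cx; apply/matrixP => i j; rewrite !mxE.
have dab := atlas_diff aa ab ax bx.
have dbc := atlas_diff ab ac bx cx.
have E : chart_to b x = (chart_to b \o chart_from c) (chart_to c x).
  by rewrite /= chart_toK.
have dab' := dab; rewrite E in dab'.
set e := delta_mx 0 j.
have -> : 'D_e (chart_to a \o chart_from c) (chart_to c x) =
  'D_e ((chart_to a \o chart_from b) \o (chart_to b \o chart_from c))
    (chart_to c x).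
  apply: near_eq_derive.
  have /chart_from_cont : chart_img c (chart_to c x) by exact: chart_toP.
  rewrite /prop_for /continuous_at chart_toK // => /(_ (chart_dom b)) cb.
  have : nbhs (chart_to c x) (chart_from c @^-1` chart_dom b).
    by apply: cb; apply: open_nbhs_nbhs; split=> //; exact: chart_open_dom.
  by apply: filterS => y /= ?; rewrite (chart_toK (c := b)).
rewrite chain_row // -E; apply: eq_bigr => k _; by rewrite !mxE.
Qed.

Lemma dcoord_id (R : realType) (n : nat) (M : smooth_manifold R n)
    (a : chart R n M) (x : M) :
  chart_dom a x -> dcoord a a x = 1%:M.
Proof.
move=> ax; apply/matrixP => i j; rewrite !mxE.
have ix : chart_img a (chart_to a x) by exact: chart_toP.
rewrite (@near_eq_derive _ _ _ _ idfun).
  by rewrite derive_id mxE eqxx.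
have : nbhs (chart_to a x) (chart_img a).
  by apply: open_nbhs_nbhs; split=> //; exact: chart_open_img.
by apply: filterS => y iy /=; rewrite chart_fromK.
Qed.

Lemma uncoord_law (R : realType) (n : nat) (M : smooth_manifold R n)
    (a : chart R n M) (z : phase R n) (b c : chart R n M) :
  atlas b -> atlas c -> chart_dom b (chart_from a z.1) ->
  chart_dom c (chart_from a z.1) ->
  uncoord_comp a z c = uncoord_comp a z b *m dcoord b c (chart_from a z.1).
Proof.
move=> ab ac bx cx; rewrite /uncoord_comp.
case: asboolP => [[aa iz _ _]|h]; case: asboolP => [h'|h'].
- by rewrite -mulmxA -dcoord_comp //; exact: chart_fromP.
- by case: h'.
- by case: h; case: h'.
- by rewrite mul0mx.
Qed.

Lemma uncoord_out (R : realType) (n : nat) (M : smooth_manifold R n)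
    (a : chart R n M) (z : phase R n) (b : chart R n M) :
  ~ (atlas b /\ chart_dom b (chart_from a z.1)) -> uncoord_comp a z b = 0.
Proof.
by move=> h; rewrite /uncoord_comp; case: asboolP => // -[_ _ ab bx]; case: h.
Qed.

(* The covector with coordinates [(x, p)] in the chart [a]; the zero covector
   if [x] is not in the image of [a]. *)
Definition uncoord (R : realType) (n : nat) (M : smooth_manifold R n)
    (a : chart R n M) (z : phase R n) : cotangent_bundle M :=
  Covector (@uncoord_law R n M a z) (@uncoord_out R n M a z).

Lemma uncoordK (R : realType) (n : nat) (M : smooth_manifold R n)
    (a : chart R n M) (z : phase R n) :
  atlas a -> chart_img a z.1 -> coord a (uncoord a z) = z.
Proof.
case: z => x p aa /= ix; rewrite /coord /= /uncoord_comp /= chart_fromK //.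
have ax := chart_fromP ix.
by case: asboolP => [_|[]//]; rewrite dcoord_id // mulmx1.
Qed.

Lemma coordK (R : realType) (n : nat) (M : smooth_manifold R n)
    (a : chart R n M) (u : cotangent_bundle M) :
  atlas a -> chart_dom a (base u) -> uncoord a (coord a u) = u.
Proof.
case: u => x f fl fo aa /= ax.
have ix := chart_toP ax.
rewrite /uncoord /coord /=.
have E : chart_from a (chart_to a x) = x by exact: chart_toK.
have Ec : uncoord_comp a (chart_to a x, f a) = f.
  apply/funext => b; rewrite /uncoord_comp /= E.
  case: asboolP => [[_ _ ab bx]|h]; first by rewrite -fl.
  by rewrite fo // => -[ab bx]; apply: h.
move: (@uncoord_law _ _ _ _ _) (@uncoord_out _ _ _ _ _) => /=.
move: E Ec; rewrite /=.
move: (chart_from a (chart_to a x)) (uncoord_comp _ _) => x' f' -> -> l o.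
by congr Covector; exact: Prop_irrelevance.
Qed.

Section calculus.
Context (R : realType) (n : nat).
Implicit Types (f h F : phase R n -> R) (z v w : phase R n).

Definition d_x (i : 'I_n) f z : R := 'D_((delta_mx 0 i, 0) : phase R n) f z.
Definition d_p (i : 'I_n) f z : R := 'D_((0, delta_mx 0 i) : phase R n) f z.

Definition poisson f h z : R :=
  \sum_i (d_p i f z * d_x i h z - d_p i h z * d_x i f z).

(* From here on, [F] is the local expression K(x, p). *)
Definition sqrf F z : R := F z ^+ 2.

Definition g_up F z : 'M[R]_n :=
  \matrix_(i, j) (2^-1 * d_p i (d_p j (sqrf F)) z).

Definition g_low F z : 'M[R]_n := invmx (g_up F z).

Definition nlconn F z : 'M[R]_n :=
  \matrix_(i, j)
    (4^-1 * poisson (fun y => g_low F y i j) (sqrf F) z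
     - 4^-1 * \sum_k (g_low F z i k * d_p k (d_x j (sqrf F)) z
                      + g_low F z j k * d_p k (d_x i (sqrf F)) z)).

Definition hframe F z (i : 'I_n) : phase R n :=
  (delta_mx 0 i, row i (nlconn F z)).
Definition vframe (i : 'I_n) : phase R n := (0, delta_mx 0 i).
Definition deltap F z (i : 'I_n) v : R :=
  v.2 0 i - \sum_j nlconn F z i j * v.1 0 j.

Definition sasaki F z v w : R :=
  \sum_i \sum_j g_low F z i j * v.1 0 i * w.1 0 j
  + \sum_i \sum_j g_up F z i j * deltap F z i v * deltap F z j w.

(* [v = v.1^i delta/delta x^i + deltap_i(v) d/dp_i]. *)
Definition acs F z v : phase R n :=
  \sum_i v.1 0 i *: (- \sum_j g_low F z i j *: vframe j)
  + \sum_i deltap F z i v *: (\sum_j g_up F z i j *: hframe F z j).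

Definition liouville_field z : phase R n := (0, z.2).
Definition reeb F z : phase R n := acs F z (liouville_field z).
Definition liouville_form z v : R := \sum_i z.2 0 i * v.1 0 i.

Definition contact_distr F z : set (phase R n) :=
  [set v | sasaki F z v (reeb F z) = 0 /\
           sasaki F z v (liouville_field z) = 0].

(* [-J] composed with the [G]-orthogonal projection along [xi]; see
   [phi_contact_distr] and [phi_reeb]. Only its restriction to the tangent
   spaces of the indicatrix bundle is used. *)
Definition phi F z v : phase R n :=
  let xi := reeb F z in
  - acs F z (v - (sasaki F z v xi / sasaki F z xi xi) *: xi).

Lemma phi_contact_distr F z v :
  contact_distr F z v -> phi F z v = - acs F z v.
Proof. by move=> [h _]; rewrite /phi h mul0r scale0r subr0. Qed.

Lemma phi_reeb F z :
  sasaki F z (reeb F z) (reeb F z) != 0 -> phi F z (reeb F z) = 0.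
Proof.
move=> h; rewrite /phi divff // scale1r subrr /acs.
rewrite big1 => [|i _]; last by rewrite mxE scale0r.
rewrite big1 => [|i _]; first by rewrite addr0 oppr0.
rewrite /deltap big1 => [|j _]; last by rewrite [X in _ * X]mxE mulr0.
by rewrite mxE subr0 scale0r.
Qed.

End calculus.

Definition local_expr (R : realType) (n : nat) (M : smooth_manifold R n)
    (K : cotangent_bundle M -> R) (a : chart R n M) : phase R n -> R :=
  K \o uncoord a.

Definition slit_domain (R : realType) (n : nat) (M : smooth_manifold R n)
    (a : chart R n M) : set (phase R n) :=
  [set z | chart_img a z.1 /\ z.2 != 0].

(* On the zero section K vanishes, by homogeneity. *)
Record cartan_space (R : realType) (n : nat) (M : smooth_manifold R n)
    (K : cotangent_bundle M -> R) : Prop := CartanSpace {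
  cartan_pos : forall a, atlas a -> forall z, slit_domain a z ->
    0 < local_expr K a z;
  cartan_smooth : forall a, atlas a ->
    smooth_on (slit_domain a) (local_expr K a);
  cartan_cont : forall a, atlas a -> forall z, chart_img a z.1 ->
    {for z, continuous (local_expr K a)};
  cartan_homog : forall a, atlas a -> forall z, chart_img a z.1 ->
    forall l : R, 0 < l ->
      local_expr K a (z.1, l *: z.2) = l * local_expr K a z;
  cartan_posdef : forall a, atlas a -> forall z, slit_domain a z ->
    forall v : 'rV[R]_n, v != 0 ->
      0 < \sum_i \sum_j g_up (local_expr K a) z i j * v 0 i * v 0 j }.

Definition indicatrix_bundle (R : realType) (n : nat) (M : smooth_manifold R n)
    (K : cotangent_bundle M -> R) : set (cotangent_bundle M) :=
  [set u | K u = 1].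

Definition lie_bracket (R : realType) (V : normedModType R) (X Y : V -> V)
    (z : V) : V :=
  'D_(X z) Y z - 'D_(Y z) X z.

Definition ext_d (R : realType) (V : normedModType R) (omega : V -> V -> R)
    (X Y : V -> V) (z : V) : R :=
  'D_(X z) (fun y => omega y (Y y)) z - 'D_(Y z) (fun y => omega y (X y)) z
  - omega z (lie_bracket X Y z).

Definition tangent (R : realType) (V : normedModType R) (F : V -> R) (z : V) :
    set V :=
  [set v | 'D_v F z = 0].

(* [S] is, inside the open set [O] of a coordinate space, the regular level set
   [F = c].  Tensor fields on [S] are given by smooth tensor fields on [O], of
   which only the values on vectors tangent to [S] matter.  Likewise vector
   fields on [S] are (locally) restrictions of smooth fields [X], [Y] on open
   sets [U] which are tangent to [S] along [S]; brackets and [d omega] do not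
   depend on the extension. *)
Record contact_metric_hypersurface (R : realType) (V : normedModType R)
    (O S : set V) (F : V -> R) (c : R)
    (phi : V -> V -> V) (omega : V -> V -> R) (xi : V -> V)
    (G : V -> V -> V -> R) : Prop := ContactMetricHypersurface {
  cm_open : open O;
  cm_level : O `&` S = O `&` [set z | F z = c];
  cm_level_smooth : smooth_on O F;
  cm_regular : forall z, O z -> S z -> exists v, 'D_v F z != 0;
  cm_phi_smooth : forall v, smooth_on O (fun z => phi z v);
  cm_omega_smooth : forall v, smooth_on O (fun z => omega z v);
  cm_xi_smooth : smooth_on O xi;
  cm_G_smooth : forall v w, smooth_on O (fun z => G z v w);
  cm_phi_tangent : forall z, O z -> S z -> forall v,
    tangent F z v -> tangent F z (phi z v);
  cm_phi_linear : forall z, O z -> S z -> forall (k : R) v w,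
    tangent F z v -> tangent F z w ->
    phi z (k *: v + w) = k *: phi z v + phi z w;
  cm_omega_linear : forall z, O z -> S z -> forall (k : R) v w,
    tangent F z v -> tangent F z w ->
    omega z (k *: v + w) = k * omega z v + omega z w;
  cm_xi_tangent : forall z, O z -> S z -> tangent F z (xi z);
  cm_G_linear : forall z, O z -> S z -> forall (k : R) v v' w,
    tangent F z v -> tangent F z v' -> tangent F z w ->
    G z (k *: v + v') w = k * G z v w + G z v' w;
  cm_G_sym : forall z, O z -> S z -> forall v w,
    tangent F z v -> tangent F z w -> G z v w = G z w v;
  cm_G_pos : forall z, O z -> S z -> forall v,
    tangent F z v -> v != 0 -> 0 < G z v v;
  cm_omega_xi : forall z, O z -> S z -> omega z (xi z) = 1;
  cm_omega_phi : forall z, O z -> S z -> forall v,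
    tangent F z v -> omega z (phi z v) = 0;
  cm_phi_xi : forall z, O z -> S z -> phi z (xi z) = 0;
  cm_phi_phi : forall z, O z -> S z -> forall v,
    tangent F z v -> phi z (phi z v) = - v + omega z v *: xi z;
  cm_G_phi : forall z, O z -> S z -> forall v w,
    tangent F z v -> tangent F z w ->
    G z (phi z v) (phi z w) = G z v w - omega z v * omega z w;
  cm_d_omega : forall (U : set V) (X Y : V -> V),
    open U -> U `<=` O -> smooth_on U X -> smooth_on U Y ->
    (forall z, U z -> S z -> tangent F z (X z) /\ tangent F z (Y z)) ->
    forall z, U z -> S z -> ext_d omega X Y z = G z (X z) (phi z (Y z)) }.

(* Main.v *)
Require Import Defs.
From HB Require Import structures.
From mathcomp Require Import all_boot all_order all_algebra.
From mathcomp Require Import all_classical all_reals all_analysis.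
From mathcomp Require Import ring.

(* Euler's identity gives p^j := g^{jk} p_k = (1/2) d^j K^2, and differentiating
   g_ij p^j = p_i evaluates the contraction of the Poisson bracket {g_ij, K^2}
   with p^j; as a result N_ij p^j = - (1/2) d_i K^2, i.e. K is constant along
   the horizontal distribution.  Hence v = a^i delta_i + c_i d^i is tangent to
   the indicatrix bundle exactly when c_i p^i = 0.  In the components (a, c),
   J is (a, c) |-> (c g^-1, - a g) with g = (g_ij), xi is (p g^-1, 0), omega(v)
   is the pairing of p and a, and phi v = (- c g^-1, a g - omega(v) p); every
   algebraic axiom is then matrix algebra.  Finally d omega = dp_i /\ dx^i
   equals delta p_i /\ dx^i because N is symmetric. *)

Set Implicit Arguments.
Unset Strict Implicit.
Unset Printing Implicit Defensive.

Import Order.TTheory GRing.Theory Num.Theory.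
Import numFieldNormedType.Exports.

Local Open Scope classical_set_scope.
Local Open Scope ring_scope.

(** Differentiability at [x] only sees the germ: the first-order expansion of [f] is also one of
    [g], and uniqueness of the differential then identifies ['d g x]. *)
Lemma near_eq_differentiable (R : numFieldType) (V W : normedModType R)
    (f g : V -> W) (x : V) :
  (\near x, f x = g x) -> differentiable f x -> differentiable g x.
Proof.
move=> fg df.
have fgx : f x = g x by exact: nbhs_singleton fg.
have dc := diff_continuous df.
have E : g \o shift x = cst (g x) + 'd f x +o_ 0 id.
  apply/eqaddoP => _/posnumP[e].
  have /eqaddoP /(_ e%:num) /(_ [gt0 of e%:num]) := diff_locally df.
  have : \forall y \near 0, f (y + x) = g (y + x).
    by move: fg; rewrite (near_shift 0) subr0.
  by apply: filterS2 => y /= h; rewrite !fctE /= h fgx.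
apply/diff_locallyP; split; first by rewrite (diff_unique dc E).
by rewrite (diff_unique dc E).
Qed.

(** * Smooth functions on open sets *)

Section smooth.
Context (R : realType) (V : normedModType R) (O : set V) (oO : open O).
Implicit Types W : normedModType R.

Lemma open_near (P : V -> Prop) x :
  O x -> (forall y, O y -> P y) -> \near x, P x.
Proof.
move=> Ox h; apply: (filterS h).
by apply: open_nbhs_nbhs; split.
Qed.

(** Since [O] is open, agreement on [O] is agreement near each of its points and passes to
    directional derivatives. Below, this lets an explicit formula stand in for a derivative. *)
Lemma Ck_ext W k (f g : V -> W) :
  (forall x, O x -> f x = g x) -> Ck k O f -> Ck k O g.
Proof.
elim: k f g => [|k IH] f g fg /=.
  move=> cf x Ox; have := cf x Ox; rewrite /prop_for /continuous_at -fg //.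
  by apply: cvg_trans; apply: near_eq_cvg; exact: open_near.
case=> df cf; split=> [x Ox|v].
  by apply: near_eq_differentiable (df x Ox); exact: open_near.
apply: IH (cf v) => x Ox; apply: near_eq_derive; exact: open_near.
Qed.

Lemma smooth_ext W (f g : V -> W) :
  (forall x, O x -> f x = g x) -> smooth_on O f -> smooth_on O g.
Proof. by move=> fg sf k; apply: Ck_ext (sf k). Qed.

Lemma smooth_derive W (f : V -> W) v :
  smooth_on O f -> smooth_on O (fun x => 'D_v f x).
Proof. by move=> sf k; have [_ h] := sf k.+1; exact: h. Qed.

Lemma smooth_diff W (f : V -> W) x :
  smooth_on O f -> O x -> differentiable f x.
Proof. by move=> /(_ 1%N)[df _] Ox; exact: df. Qed.

Lemma smooth_derivable W (f : V -> W) x v :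
  smooth_on O f -> O x -> derivable f x v.
Proof. by move=> sf Ox; apply/diff_derivable/smooth_diff. Qed.

Lemma smooth_cont W (f : V -> W) x :
  smooth_on O f -> O x -> {for x, continuous f}.
Proof. by move=> /(_ 0%N) sf Ox; exact: sf. Qed.

Lemma smooth_cst W (c : W) : smooth_on O (fun _ => c).
Proof.
move=> k; elim: k c => [|k IH] c /=; first by move=> x _; apply: cvg_cst.
split=> [x _|v]; first exact: differentiable_cst.
by apply: Ck_ext (IH 0) => x _; rewrite (derive_cst c x v).
Qed.

Lemma smooth_linear W (f : {linear V -> W}) : continuous f -> smooth_on O f.
Proof.
move=> cf [|k] /=; first by move=> x _; exact: cf.
split=> [x _|v]; first exact: linear_differentiable.
apply: Ck_ext (smooth_cst (f v) k) => x _.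
by rewrite deriveE ?diff_lin //; exact: linear_differentiable.
Qed.

Lemma Ck_add W k (f g : V -> W) :
  Ck k O f -> Ck k O g -> Ck k O (fun x => f x + g x).
Proof.
elim: k f g => [|k IH] f g /=.
  by move=> cf cg x Ox; apply: continuousD; [exact: cf|exact: cg].
move=> [df cf] [dg cg]; split=> [x Ox|v].
  by apply: differentiableD; [exact: df|exact: dg].
apply: Ck_ext (IH _ _ (cf v) (cg v)) => x Ox.
by rewrite -deriveD //; apply: diff_derivable; [exact: df|exact: dg].
Qed.

Lemma smooth_add W (f g : V -> W) :
  smooth_on O f -> smooth_on O g -> smooth_on O (fun x => f x + g x).
Proof. by move=> sf sg k; exact: Ck_add. Qed.

Lemma smooth_sum W (I : Type) (r : seq I) (P : pred I) (f : I -> V -> W) :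
  (forall i, P i -> smooth_on O (f i)) ->
  smooth_on O (fun x => \sum_(i <- r | P i) f i x).
Proof.
move=> sf; elim: r => [|i r IH].
  by apply: smooth_ext (smooth_cst 0) => x _; rewrite big_nil.
case Pi: (P i); last by apply: smooth_ext IH => x _; rewrite big_cons Pi.
apply: smooth_ext (smooth_add (sf i Pi) IH) => x _; by rewrite big_cons Pi.
Qed.

Lemma continuous_scale W (f : V -> R) (g : V -> W) x :
  {for x, continuous f} -> {for x, continuous g} ->
  {for x, continuous (fun y => f y *: g y)}.
Proof. by move=> cf cg; apply: cvgZ. Qed.

Lemma smooth_scale_cst W (f : V -> R) (w : W) :
  smooth_on O f -> smooth_on O (fun x => f x *: w).
Proof.
move=> sf k; elim: k f sf => [|k IH] f sf /=.
  move=> x Ox; apply: continuous_scale; first exact: smooth_cont.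
  apply: cvg_cst.
split=> [x Ox|v]; first exact/differentiableZl/smooth_diff.
apply: Ck_ext (IH _ (smooth_derive v sf)) => x Ox.
rewrite !deriveE ?diffZl //; try exact: smooth_diff.
exact/differentiableZl/smooth_diff.
Qed.

Lemma CkW W k (f : V -> W) : Ck k.+1 O f -> Ck k O f.
Proof.
elim: k f => [|k IH] f [df cf].
  by move=> x Ox; exact/differentiable_continuous/df.
by split=> // v; exact: IH (cf v).
Qed.

Lemma Ck_mul k (f g : V -> R) :
  Ck k O f -> Ck k O g -> Ck k O (fun x => f x * g x).
Proof.
elim: k f g => [|k IH] f g.
  by move=> cf cg x Ox; apply: continuousM; [exact: cf|exact: cg].
move=> Cf Cg; have [df cf] := Cf; have [dg cg] := Cg.
split=> [x Ox|v]; first by apply: differentiableM; [exact: df|exact: dg].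
(* Leibniz' rule involves [f] and [g] undifferentiated; [CkW] lowers them to order [k]. *)
apply: Ck_ext (Ck_add (IH _ _ (CkW Cf) (cg v)) (IH _ _ (CkW Cg) (cf v))).
move=> x Ox; rewrite deriveM //; apply: diff_derivable.
  exact: df.
exact: dg.
Qed.

Lemma smooth_mul (f g : V -> R) :
  smooth_on O f -> smooth_on O g -> smooth_on O (fun x => f x * g x).
Proof. by move=> sf sg k; exact: Ck_mul. Qed.

Lemma smooth_opp (f : V -> R) :
  smooth_on O f -> smooth_on O (fun x => - f x).
Proof.
move=> sf; apply: smooth_ext (smooth_mul (smooth_cst (-1 : R)) sf) => x _.
by rewrite mulN1r.
Qed.

Lemma smooth_sub (f g : V -> R) :
  smooth_on O f -> smooth_on O g -> smooth_on O (fun x => f x - g x).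
Proof. by move=> sf sg; apply: smooth_add => //; exact: smooth_opp. Qed.

Lemma smooth_inv (f : V -> R) :
  smooth_on O f -> (forall x, O x -> f x != 0) ->
  smooth_on O (fun x => (f x)^-1).
Proof.
move=> sf f0 k; elim: k => [|k IH] /=.
  by move=> x Ox; apply: cvgV; [exact: f0|exact: smooth_cont].
split=> [x Ox|v]; first by
  apply: differentiableV; [exact: smooth_diff|exact: f0].
(* The derivative of [1/f] is [-(1/f)^2 D_v f], where [1/f] has order [k] by induction. *)
apply: Ck_ext (Ck_mul (Ck_mul IH IH) (smooth_opp (smooth_derive v sf) k)).
move=> x Ox.
rewrite deriveV ?f0 //; last exact: smooth_derivable.
by rewrite [LHS]mulrN -exprVn expr2 scaleNr.
Qed.

Lemma smooth_prod (I : Type) (r : seq I) (P : pred I) (f : I -> V -> R) :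
  (forall i, P i -> smooth_on O (f i)) ->
  smooth_on O (fun x => \prod_(i <- r | P i) f i x).
Proof.
move=> sf; elim: r => [|i r IH].
  by apply: smooth_ext (smooth_cst (1 : R)) => x _; rewrite big_nil.
case Pi: (P i); last by apply: smooth_ext IH => x _; rewrite big_cons Pi.
apply: smooth_ext (smooth_mul (sf i Pi) IH) => x _; by rewrite big_cons Pi.
Qed.

Lemma smooth_det m (A : V -> 'M[R]_m) :
  (forall i j, smooth_on O (fun x => A x i j)) ->
  smooth_on O (fun x => \det (A x)).
Proof.
move=> sA; apply: smooth_sum => s _; apply: smooth_mul.
  exact: smooth_cst.
by apply: smooth_prod => i _; exact: sA.
Qed.

End smooth.

(** * Symmetry of second derivatives *)

Section clairaut.
Context (R : realType) (V : normedModType R).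
Implicit Types (f : V -> R) (v w x y : V).

(** The difference quotient of the restriction to the line at [t] is literally that of [f] at
    [t *: v + y] along [v]. *)
Lemma is_derive_line f y v t :
  differentiable f (t *: v + y) ->
  is_derive t 1 (fun s => f (s *: v + y)) ('D_v f (t *: v + y)).
Proof.
move=> df; have /derivableP := @diff_derivable _ _ _ _ _ v df.
rewrite /derivable /derive => -[].
rewrite /derive /derivable.
set g1 := (X in X @ 0^') => h1 h2.
set g := fun s => f (s *: v + y).
have E : (fun h => h^-1 *: ((g \o shift t) (h *: 1) - g t)) = g1.
  apply/funext => h; rewrite /g1 /g /= scalerDl addrA.
  by rewrite [h *: 1]mulr1.
by split; rewrite /derivable /derive E.
Qed.

Lemma mvt0 (g dg : R -> R) (h : R) : 0 < h ->
  (forall t : R, 0 <= t <= h -> is_derive t 1 g (dg t)) ->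
  exists2 c, 0 <= c <= h & g h - g 0 = h * dg c.
Proof.
move=> h0 gdg.
have [|t||c] := @MVT_segment R g dg 0 h.
- exact: ltW.
- by rewrite in_itv /= => /andP[t0 th]; apply: gdg; rewrite !ltW.
- apply: derivable_within_continuous => t; rewrite in_itv /= => /gdg tt.
  exact: ex_derive.
- rewrite in_itv /= => c0h; rewrite subr0 => E.
  by exists c => //; rewrite mulrC -E.
Qed.

(** The mean value theorem is applied twice: along [v] to the difference [g] of [f] on two parallel
    lines, then along [w] to ['D_v f]. *)
Lemma second_difference f (O : set V) x v w (h : R) : 0 < h ->
  (forall y, O y -> differentiable f y) ->
  (forall y, O y -> differentiable (fun z => 'D_v f z) y) ->
  (forall s t : R, 0 <= s <= h -> 0 <= t <= h -> O (s *: v + (t *: w + x))) ->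
  exists c d, [/\ 0 <= c <= h, 0 <= d <= h &
    f (h *: v + (h *: w + x)) - f (h *: v + x) - (f (h *: w + x) - f x)
    = h ^+ 2 * 'D_w (fun z => 'D_v f z) (c *: v + (d *: w + x))].
Proof.
move=> h0 df ddf Oh.
have hh : 0 <= h <= h by rewrite lexx ltW.
have oh : (0 : R) <= 0 <= h by rewrite lexx ltW.
have Ov s : 0 <= s <= h -> O (s *: v + x).
  by move=> sh; have := Oh s 0 sh oh; rewrite scale0r add0r.
pose g s := f (s *: v + (h *: w + x)) - f (s *: v + x).
have [|c c0h] := @mvt0 g (fun s => 'D_v f (s *: v + (h *: w + x))
                              - 'D_v f (s *: v + x)) h h0.
  by move=> s sh; apply: is_deriveB; apply: is_derive_line; apply: df;
    [exact: Oh|exact: Ov].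
have swap t : c *: v + (t *: w + x) = t *: w + (c *: v + x) by rewrite addrCA.
have [|d d0h] := @mvt0 (fun t => 'D_v f (t *: w + (c *: v + x)))
  (fun t => 'D_w (fun z => 'D_v f z) (t *: w + (c *: v + x))) h h0.
  by move=> t th; apply: is_derive_line; apply: ddf; rewrite -swap; exact: Oh.
rewrite scale0r add0r -!swap /g !scale0r !add0r => E1 E2.
by exists c, d; split=> //; rewrite E2 E1 expr2 -mulrA.
Qed.

Lemma near_square (P : V -> Prop) x v w : (\near x, P x) ->
  exists2 h : R, 0 < h & forall s t : R, 0 <= s <= h -> 0 <= t <= h ->
    P (s *: v + (t *: w + x)).
Proof.
move=> /nbhs_ballP [e /= e0 he].
(* With side [e / 2 / m] every displacement has norm at most [e / 2]; the summand 1 keeps [m]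
   positive even if [v] and [w] vanish. *)
pose m := `|v| + `|w| + 1.
have m0 : 0 < m by rewrite ltr_wpDl // addr_ge0.
exists (e / 2 / m); first by rewrite !divr_gt0.
move=> s t /andP[s0 sh] /andP[t0 th]; apply: he.
rewrite -ball_normE /= addrA opprD addrCA subrr addr0 normrN.
apply: le_lt_trans (ler_normD _ _) _; rewrite !normrZ !ger0_norm //.
apply: (@le_lt_trans _ _ (e / 2 / m * `|v| + e / 2 / m * `|w|)).
  by apply: lerD; apply: ler_wpM2r.
rewrite -mulrDr.
apply: (@le_lt_trans _ _ (e / 2)); last first.
  by rewrite ltr_pdivrMr // ltr_pMr // ltr1n.
rewrite -mulrA ler_piMr ?divr_ge0 ?ltW //.
by rewrite mulrC ltr_pdivrMr // mul1r ltrDl.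
Qed.

Lemma dist_half (a b c e : R) : `|a - c| <= e / 2 -> `|b - c| <= e / 2 ->
  `|a - b| <= e.
Proof.
move=> h1 h2; rewrite -(subrKA c) (splitr e).
by rewrite (le_trans (ler_normD _ _)) // lerD // distrC.
Qed.

(** The second difference over the square spanned by [h *: v] and [h *: w] is symmetric in [v] and
    [w], so both mixed derivatives take a common value, each at some point of the square. Continuity
    at [x] puts this value within [e / 2] of either side. *)
Lemma clairaut f (O : set V) x v w : open O -> O x ->
  (forall y, O y -> differentiable f y) ->
  (forall y, O y -> differentiable (fun z => 'D_v f z) y) ->
  (forall y, O y -> differentiable (fun z => 'D_w f z) y) ->
  {for x, continuous (fun z => 'D_w (fun y => 'D_v f y) z)} ->
  {for x, continuous (fun z => 'D_v (fun y => 'D_w f y) z)} ->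
  'D_w (fun y => 'D_v f y) x = 'D_v (fun y => 'D_w f y) x.
Proof.
move=> oO Ox df dv dw cvw cwv.
set a := LHS; set b := RHS; apply/eqP; rewrite -subr_eq0 -normr_le0.
apply/ler_addgt0Pl => e e0; rewrite addr0.
have e20 : 0 < e / 2 by rewrite divr_gt0.
move/cvgrPdist_le: (cvw) => /(_ _ e20) N1.
move/cvgrPdist_le: (cwv) => /(_ _ e20) N2.
have N3 : \near x, O x by apply: open_nbhs_nbhs.
have [h h0] := near_square v w (filterI N3 (filterI N1 N2)).
move=> H.
have [s t sh th|c [d [ch dh E1]]] := @second_difference f O x v w h h0 df dv.
  by have [] := H s t sh th.
have [s t sh th|c' [d' [ch' dh' E2]]] :=
  @second_difference f O x w v h h0 df dw.
  by rewrite addrCA; have [] := H t s th sh.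
have h2 : h ^+ 2 != 0 by rewrite sqrf_eq0 gt_eqF.
have : 'D_w (fun z => 'D_v f z) (c *: v + (d *: w + x)) =
       'D_v (fun z => 'D_w f z) (c' *: w + (d' *: v + x)).
  have swap (p q r s : R) : p - q - (r - s) = p - r - (q - s) by ring.
  apply: (mulfI h2); apply: etrans (esym E1) _; apply: etrans _ E2.
  by rewrite [h *: v + (h *: w + x)]addrCA; exact: swap.
move=> E.
have [_ [H1 _]] := H c d ch dh.
(* The second mean value point has its [w] coordinate first, hence the exchanged arguments. *)
have [_ [_ H2]] := H d' c' dh' ch'.
rewrite [d' *: v + _]addrCA /= -E in H2.
exact: dist_half H1 H2.
Qed.
End clairaut.

Lemma smooth_clairaut (R : realType) (V : normedModType R) (O : set V)
    (f : V -> R) (v w x : V) : open O -> smooth_on O f -> O x ->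
  'D_w (fun y => 'D_v f y) x = 'D_v (fun y => 'D_w f y) x.
Proof.
move=> oO sf Ox; apply: (@clairaut _ _ f O) => //.
- by move=> y Oy; apply: smooth_diff sf Oy.
- by move=> y Oy; apply: smooth_diff (smooth_derive v sf) Oy.
- by move=> y Oy; apply: smooth_diff (smooth_derive w sf) Oy.
- by apply: smooth_cont (smooth_derive w (smooth_derive v sf)) Ox.
- by apply: smooth_cont (smooth_derive v (smooth_derive w sf)) Ox.
Qed.

Lemma linear_comp_derive (R : numFieldType) (U V W : normedModType R)
    (L : {linear V -> W}) (f : U -> V) (x v : U) :
  continuous L -> differentiable f x ->
  differentiable (fun y => L (f y)) x /\
  'D_v (fun y => L (f y)) x = L ('D_v f x).
Proof.
move=> cL df; have dL : differentiable L (f x) by exact: linear_differentiable.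
have dc := differentiable_comp df dL; split; first exact: dc.
rewrite (deriveE v dc) (deriveE v df).
have := congr1 (fun g => g v) (diff_comp df dL) => /= ->.
by rewrite diff_lin.
Qed.

(** * Positions and momenta as linear coordinates on phase space *)

Section phase_coordinates.
Context (R : realType) (n : nat).
Implicit Types (z v w : phase R n).

Definition pos_coord (i : 'I_n) z : R := z.1 0 i.
Definition mom_coord (i : 'I_n) z : R := z.2 0 i.

Fact pos_coord_linear i : linear (pos_coord i).
Proof. by move=> k v w; rewrite /pos_coord !mxE. Qed.
Fact mom_coord_linear i : linear (mom_coord i).
Proof. by move=> k v w; rewrite /mom_coord !mxE. Qed.

HB.instance Definition _ i :=
  GRing.isLinear.Build R (phase R n) R _ (pos_coord i) (pos_coord_linear i).
HB.instance Definition _ i :=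
  GRing.isLinear.Build R (phase R n) R _ (mom_coord i) (mom_coord_linear i).

Lemma pos_coord_cont i : continuous (pos_coord i).
Proof.
move=> z; apply: (@continuous_comp _ _ _ fst (fun u : 'rV[R]_n => u 0 i)).
  exact: cvg_fst.
exact: coord_continuous.
Qed.
Lemma mom_coord_cont i : continuous (mom_coord i).
Proof.
move=> z; apply: (@continuous_comp _ _ _ snd (fun u : 'rV[R]_n => u 0 i)).
  exact: cvg_snd.
exact: coord_continuous.
Qed.

Lemma fst_sum (I : Type) (r : seq I) (Q : pred I) (f : I -> phase R n) :
  (\sum_(i <- r | Q i) f i).1 = \sum_(i <- r | Q i) (f i).1.
Proof. by apply: (big_morph fst). Qed.
Lemma snd_sum (I : Type) (r : seq I) (Q : pred I) (f : I -> phase R n) :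
  (\sum_(i <- r | Q i) f i).2 = \sum_(i <- r | Q i) (f i).2.
Proof. by apply: (big_morph snd). Qed.

Lemma phase_sum_delta v :
  v = \sum_i v.1 0 i *: ((delta_mx 0 i, 0) : phase R n)
    + \sum_i v.2 0 i *: ((0, delta_mx 0 i) : phase R n).
Proof.
rewrite [LHS]surjective_pairing [RHS]surjective_pairing /=.
rewrite !(fst_sum, snd_sum) /= -!row_sum_delta.
by rewrite !big1 ?addr0 ?add0r // => i _; rewrite scaler0.
Qed.

Lemma derive_phase (f : phase R n -> R) z v : differentiable f z ->
  'D_v f z = \sum_i v.1 0 i * d_x i f z + \sum_i v.2 0 i * d_p i f z.
Proof.
move=> df; rewrite deriveE // [in LHS](phase_sum_delta v) linearD !linear_sum.
by congr (_ + _); apply: eq_bigr => i _; rewrite linearZ /d_x /d_p deriveE.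
Qed.

End phase_coordinates.

Lemma derive_sum_mul (R : realType) (V : normedModType R) (n : nat)
    (f g : 'I_n -> V -> R) (x v : V) :
  (forall i, differentiable (f i) x) -> (forall i, differentiable (g i) x) ->
  'D_v (fun y => \sum_i f i y * g i y) x =
  \sum_i ('D_v (f i) x * g i x + f i x * 'D_v (g i) x).
Proof.
move=> df dg.
have -> : (fun y => \sum_i f i y * g i y) = \sum_i (f i * g i).
  by apply/funext => y; rewrite fct_sumE.
rewrite derive_sum => [|i]; last first.
  by apply: derivableM; exact: diff_derivable.
apply: eq_bigr => i _; rewrite deriveM; try exact: diff_derivable.
by rewrite addrC mulrC.
Qed.

(** Index algebra behind [horizontal_sqrf], for a fixed [i]: [N j] is N_ij, [b k] is g_ik, [g j k]
    is g_jk, [P j] is p^j; [hp] and [hx] are the momentum and position derivatives of K^2, [bp] and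
    [bx] those of g_ij, [c] and [e] are mixed second derivatives of K^2, and [t] is d_i K^2. *)
Lemma horizontal_contraction (R : numFieldType) (n : nat)
    (N b P hp hx e : 'I_n -> R) (bp bx c g : 'I_n -> 'I_n -> R) (t : R) :
  (forall j, N j = 4^-1 * (\sum_k (bp k j * hx k - hp k * bx k j))
     - 4^-1 * \sum_k (b k * c j k + g j k * e k)) ->
  (forall k, \sum_j bp k j * P j = 0) ->
  (forall k, \sum_j bx k j * P j = - \sum_j b j * (2^-1 * c k j)) ->
  (forall k, hp k = 2 * P k) ->
  \sum_k (\sum_j g j k * P j) * e k = 2 * t ->
  t + \sum_j N j * hp j = 0.
Proof.
move=> NE bpP bxP hpP gP.
(* Contracted with p^j, the bracket loses its first half by [bpP]; by [bxP] its second half becomes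
   the very [c] sum that [NE] subtracts. Only [T3] survives. *)
have T1 : \sum_j (\sum_k (bp k j * hx k - hp k * bx k j)) * P j =
    \sum_j (\sum_k b k * c j k) * P j.
  transitivity (\sum_k (hx k * (\sum_j bp k j * P j)
                        - hp k * (\sum_j bx k j * P j))).
    under eq_bigr do rewrite mulr_suml.
    rewrite exchange_big; apply: eq_bigr => k _ /=.
    rewrite !mulr_sumr -sumrB; apply: eq_bigr => j _; by ring.
  apply: eq_bigr => k _; rewrite bpP bxP mulr0 sub0r mulrN opprK hpP.
  rewrite mulr_sumr mulr_suml; apply: eq_bigr => j _. by field.
have T3 : \sum_j (\sum_k g j k * e k) * P j = 2 * t.
  rewrite -gP; under eq_bigr do rewrite mulr_suml.
  rewrite exchange_big; apply: eq_bigr => k _ /=.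
  by rewrite mulr_suml; apply: eq_bigr => j _; rewrite mulrAC.
have -> : \sum_j N j * hp j = 2 * (4^-1 *
      (\sum_j (\sum_k (bp k j * hx k - hp k * bx k j)) * P j)
    - 4^-1 * (\sum_j (\sum_k b k * c j k) * P j
              + \sum_j (\sum_k g j k * e k) * P j)).
  rewrite -big_split [in X in X - _]mulr_sumr [in X in _ - X]mulr_sumr.
  rewrite -sumrB mulr_sumr; apply: eq_bigr => j _ /=.
  by rewrite NE hpP [\sum_k (b k * _ + _)]big_split /=; ring.
by rewrite T1 T3; field.
Qed.

(** * Linear algebra in an adapted frame *)

Section dot.
Context (R : comNzRingType) (n : nat).
Implicit Types (u v w : 'rV[R]_n) (A : 'M[R]_n).

(** The pairing is an entry of a matrix product, so that a symmetric matrix moves across it by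
    transposition. *)
Definition dot u v : R := (u *m v^T) 0 0.

Lemma dotE u v : dot u v = \sum_i u 0 i * v 0 i.
Proof. by rewrite /dot mxE; apply: eq_bigr => i _; rewrite mxE. Qed.

Lemma dotC u v : dot u v = dot v u.
Proof. by rewrite !dotE; apply: eq_bigr => i _; rewrite mulrC. Qed.

Lemma dotDl u v w : dot (u + v) w = dot u w + dot v w.
Proof. by rewrite /dot mulmxDl mxE. Qed.

Lemma dotNl u v : dot (- u) v = - dot u v.
Proof. by rewrite /dot mulNmx mxE. Qed.

Lemma dotZl k u v : dot (k *: u) v = k * dot u v.
Proof. by rewrite /dot -scalemxAl mxE. Qed.

Lemma dotDr u v w : dot u (v + w) = dot u v + dot u w.
Proof. by rewrite dotC dotDl !(dotC u). Qed.

Lemma dotNr u v : dot u (- v) = - dot u v.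
Proof. by rewrite dotC dotNl dotC. Qed.

Lemma dotZr k u v : dot u (k *: v) = k * dot u v.
Proof. by rewrite dotC dotZl dotC. Qed.

Lemma dot0l v : dot 0 v = 0.
Proof. by rewrite /dot mul0mx mxE. Qed.

Lemma dot0r v : dot v 0 = 0.
Proof. by rewrite dotC dot0l. Qed.

Lemma dot_sym A u v : A^T = A -> dot (u *m A) v = dot u (v *m A).
Proof. by move=> sA; rewrite /dot trmx_mul sA mulmxA. Qed.

End dot.

Section sasaki_algebra.
Context (R : numFieldType) (n : nat) (A B N : 'M[R]_n) (p : 'rV[R]_n).
Hypotheses (sA : A^T = A) (sB : B^T = B) (AB : A *m B = 1%:M).
Implicit Types (v w : phase R n).

(* A, B and N stand for (g^ij), (g_ij) and (N_ij); [vert v] lists the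
   delta p_i(v). *)
Definition vert v : 'rV[R]_n := v.2 - v.1 *m N.

(** A momentum coordinate is the vertical component plus the [N]-image of the position part; this
    explains the summand [vert v *m A *m N]. *)
Definition mxJ v : phase R n :=
  (vert v *m A, vert v *m A *m N - v.1 *m B).

Definition mxG v w : R :=
  dot (v.1 *m B) w.1 + dot (vert v *m A) (vert w).

Definition mxXi : phase R n := (p *m A, p *m A *m N).

(** Kept in the shape of [phi]. The quotient matters off the indicatrix, where xi need not have unit
    length. *)
Definition contact_endo v : phase R n :=
  - mxJ (v - (mxG v mxXi / mxG mxXi mxXi) *: mxXi).

Let BA : B *m A = 1%:M. Proof. exact: mulmx1C. Qed.

Lemma dotAB (u v : 'rV[R]_n) : dot (u *m A) (v *m B) = dot u v.
Proof. by rewrite dot_sym // -mulmxA BA mulmx1. Qed.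

(** The position part and [vert] together are coordinates on tangent vectors; vector identities
    below are checked in these two components. *)
Lemma vert_inj v w : v.1 = w.1 -> vert v = vert w -> v = w.
Proof.
case: v w => [a b] [a' b'] /= -> ; rewrite /vert /= => /addIr -> //.
Qed.

Lemma fstP k v w : (k *: v + w).1 = k *: v.1 + w.1.
Proof. by []. Qed.

Lemma vertP k v w : vert (k *: v + w) = k *: vert v + vert w.
Proof.
rewrite /vert /= mulmxDl -scalemxAl scalerBr opprD.
by rewrite addrACA.
Qed.

Lemma vertN v : vert (- v) = - vert v.
Proof. by rewrite /vert /= mulNmx opprB opprK addrC. Qed.

Lemma vert_mxJ v : vert (mxJ v) = - (v.1 *m B).
Proof. by rewrite /vert /= addrAC subrr add0r. Qed.

Lemma vert_mxXi : vert mxXi = 0.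
Proof. by rewrite /vert /= subrr. Qed.

Lemma mxGC v w : mxG v w = mxG w v.
Proof.
by rewrite /mxG; congr (_ + _); rewrite dot_sym // dotC.
Qed.

Lemma mxGP k v v' w :
  mxG (k *: v + v') w = k * mxG v w + mxG v' w.
Proof.
rewrite /mxG vertP (fstP k v v').
move: (vert v) (vert v') (vert w) => a b c.
by rewrite !mulmxDl -!scalemxAl !dotDl !dotZl mulrDr addrACA.
Qed.

(** The vertical part of xi is zero and [B] undoes the [A] in its position part; this is the duality
    of xi and the Liouville form. *)
Lemma mxG_mxXi v : mxG v mxXi = dot p v.1.
Proof.
rewrite /mxG vert_mxXi dot0r addr0 /= (dot_sym _ _ sB) -mulmxA AB mulmx1.
exact: dotC.
Qed.

(** The horizontal half is the form of [A] evaluated at [v.1 *m B], so positivity of [A] controls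
    both halves. *)
Lemma mxG_gt0 v :
  (forall u : 'rV[R]_n, u != 0 -> 0 < dot (u *m A) u) ->
  v != 0 -> 0 < mxG v v.
Proof.
move=> posA v0.
have posA0 (u : 'rV[R]_n) : 0 <= dot (u *m A) u.
  by have [->|/posA/ltW//] := eqVneq u 0; rewrite dot0r.
have E : dot (v.1 *m B) v.1 = dot (v.1 *m B *m A) (v.1 *m B).
  by rewrite -mulmxA BA mulmx1 dotC.
have [v10|v10] := eqVneq v.1 0.
  rewrite /mxG v10 dot0r add0r; apply: posA.
  apply: contra_neq v0 => vv0; apply: vert_inj => //.
  by rewrite vv0 /vert /= mul0mx subrr.
rewrite /mxG E; apply: ltr_wpDr => //; apply: posA.
apply: contra_neq v10 => /(congr1 (mulmx^~ A)).
by rewrite /= -mulmxA BA mulmx1 mul0mx.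
Qed.

(** * The contact endomorphism over a point of the indicatrix, where g^ij p_i p_j = 1 *)

Hypothesis pA1 : dot p (p *m A) = 1.

Lemma mxG_mxXi1 : mxG mxXi mxXi = 1.
Proof. by rewrite mxG_mxXi. Qed.

Lemma contact_endo_fst v : (contact_endo v).1 = - (vert v *m A).
Proof.
by rewrite /contact_endo /= addrC -scaleNr vertP vert_mxXi scaler0 add0r.
Qed.

(** J xi is vertical with component [- p], so projecting out xi changes only the vertical component,
    by a multiple of [p]. *)
Lemma vert_contact_endo v :
  vert (contact_endo v) = v.1 *m B - dot p v.1 *: p.
Proof.
rewrite /contact_endo vertN vert_mxJ opprK mxG_mxXi1 divr1 mxG_mxXi /=.
by rewrite mulmxBl -scalemxAl -mulmxA AB mulmx1.
Qed.

Lemma contact_endoP k v w :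
  contact_endo (k *: v + w) = k *: contact_endo v + contact_endo w.
Proof.
have [F V] := (contact_endo_fst, vert_contact_endo).
apply: vert_inj; last first.
  rewrite (vertP k (contact_endo v) (contact_endo w)).
  apply: etrans (V _) _.
  apply: etrans _ (esym (congr2 (fun a b => k *: a + b) (V v) (V w))).
  rewrite (fstP k v w) mulmxDl -scalemxAl dotDr dotZr.
  by rewrite scalerBr scalerA scalerDl opprD addrACA.
apply: etrans (F _) _.
apply: etrans _ (esym (congr2 (fun a b => k *: a + b) (F v) (F w))).
rewrite (vertP k v w).
by move: (vert v) (vert w) => a b; rewrite mulmxDl -scalemxAl opprD scalerN.
Qed.

(** The pairing of [v.1 *m B] with [p *m A] is [dot p v.1], and by [pA1] the multiple of [p] cancels
    exactly this. *)
Lemma contact_endo_tangent v : dot (vert (contact_endo v)) (p *m A) = 0.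
Proof.
rewrite vert_contact_endo dotDl dotNl dotZl pA1 mulr1 -(dot_sym _ _ sA).
by rewrite -mulmxA BA mulmx1 dotC subrr.
Qed.

Lemma contact_endo_mxXi : contact_endo mxXi = 0.
Proof.
apply: vert_inj; first by rewrite contact_endo_fst vert_mxXi mul0mx oppr0.
rewrite vert_contact_endo /= pA1 scale1r -mulmxA AB mulmx1 subrr.
by rewrite /vert /= mul0mx subr0.
Qed.

Lemma dot_contact_endo v : dot (vert v) (p *m A) = 0 ->
  dot p (contact_endo v).1 = 0.
Proof.
by move=> tv; rewrite contact_endo_fst dotNr -(dot_sym _ _ sA) dotC tv oppr0.
Qed.

(** The endomorphism exchanges the two components up to [A], [B] and a sign. The multiple of [p]
    from the first application becomes the xi term; the one from the second vanishes by
    [dot_contact_endo]. *)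
Lemma contact_endo2 v : dot (vert v) (p *m A) = 0 ->
  contact_endo (contact_endo v) = - v + dot p v.1 *: mxXi.
Proof.
move=> tv; apply: vert_inj.
  rewrite contact_endo_fst vert_contact_endo mulmxBl -scalemxAl -mulmxA BA.
  by rewrite mulmx1 opprB addrC.
rewrite vert_contact_endo dot_contact_endo // scale0r subr0 contact_endo_fst.
rewrite mulNmx -mulmxA AB mulmx1 addrC (vertP _ mxXi (- v)) vertN vert_mxXi.
by rewrite scaler0 add0r.
Qed.

Lemma mxG_contact_endo v w :
  dot (vert v) (p *m A) = 0 -> dot (vert w) (p *m A) = 0 ->
  mxG (contact_endo v) (contact_endo w)
  = mxG v w - dot p v.1 * dot p w.1.
Proof.
move=> tv tw.
(* Only the two components of each image enter, so the images are replaced by arbitrary [x] and [y]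
   having these components. *)
suff K x y : x.1 = - (vert v *m A) -> vert x = v.1 *m B - dot p v.1 *: p ->
    y.1 = - (vert w *m A) -> vert y = w.1 *m B - dot p w.1 *: p ->
    mxG x y = mxG v w - dot p v.1 * dot p w.1.
  exact: K (contact_endo_fst v) (vert_contact_endo v)
           (contact_endo_fst w) (vert_contact_endo w).
rewrite /mxG => -> -> -> ->; rewrite mulNmx -mulmxA AB mulmx1.
move: (vert v) (vert w) tv tw => a b ta tb.
rewrite dotNl dotNr opprK -(dot_sym _ _ sA) mulmxBl -scalemxAl.
rewrite -mulmxA BA mulmx1.
rewrite !(dotDl, dotDr, dotNl, dotNr, dotZl, dotZr).
rewrite dotAB (dotC (p *m A) p) pA1 (dotC v.1 p) -(dot_sym _ _ sB); ring.
Qed.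

(** The value is that of [delta p_i /\ dx^i] on [v] and [w]; tangency of [v] removes the multiple of
    [p] in [vert_contact_endo]. *)
Lemma mxG_endo v w : dot (vert v) (p *m A) = 0 ->
  mxG v (contact_endo w) = dot (vert v) w.1 - dot (vert w) v.1.
Proof.
move=> tv; rewrite /mxG contact_endo_fst vert_contact_endo.
move: (vert v) (vert w) tv => a b ta.
rewrite !(dotDr, dotNr, dotZr) dotAB (dot_sym _ _ sA) ta.
rewrite [dot (v.1 *m B) _]dotC dotAB; ring.
Qed.

End sasaki_algebra.

(** With [hx] and [hp] the partial derivatives of K^2 and [q] the row p^j: constancy along the
    horizontal frame leaves only the vertical component of [v]. *)
Lemma sum_horizontal (R : numFieldType) (n : nat) (N : 'M[R]_n)
    (hx hp : 'I_n -> R) (q : 'rV[R]_n) (v : phase R n) :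
  (forall i, hx i + \sum_j N i j * hp j = 0) ->
  (forall j, hp j = 2 * q 0 j) ->
  \sum_i v.1 0 i * hx i + \sum_i v.2 0 i * hp i = 2 * dot (vert N v) q.
Proof.
move=> hxP hpP; rewrite /vert dotDl dotNl !dotE mulrBr addrC; congr (_ + _).
  by rewrite mulr_sumr; apply: eq_bigr => i _; rewrite hpP mulrCA.
have -> : \sum_i v.1 0 i * hx i = - \sum_i \sum_j v.1 0 i * N i j * hp j.
  rewrite -sumrN; apply: eq_bigr => i _.
  have /eqP := hxP i; rewrite addr_eq0 => /eqP ->.
  by rewrite mulrN mulr_sumr; congr (- _); apply: eq_bigr => j _; rewrite mulrA.
congr (- _); rewrite exchange_big mulr_sumr; apply: eq_bigr => j _ /=.
by rewrite -mulr_suml hpP mxE mulrCA.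
Qed.

(** * Smoothness of fields assembled from rows and matrices *)

Lemma smooth_phase (R : realType) (n : nat) (O : set (phase R n))
    (f : phase R n -> phase R n) : open O ->
  (forall i, smooth_on O (fun z => (f z).1 0 i)) ->
  (forall i, smooth_on O (fun z => (f z).2 0 i)) -> smooth_on O f.
Proof.
move=> oO s1 s2.
apply: (smooth_ext oO (f := fun z =>
    \sum_i (f z).1 0 i *: ((delta_mx 0 i, 0) : phase R n)
  + \sum_i (f z).2 0 i *: ((0, delta_mx 0 i) : phase R n))).
  by move=> z _; rewrite -phase_sum_delta.
apply: smooth_add => //; apply: smooth_sum => // i _;
  exact: smooth_scale_cst.
Qed.

Section smooth_rows.
Context (R : realType) (n : nat) (V : normedModType R).
Context (O : set V) (oO : open O).
Implicit Types (u v : V -> 'rV[R]_n) (M : V -> 'M[R]_n).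

Definition smooth_row u := forall i, smooth_on O (fun z => u z 0 i).

Lemma smooth_row_cst (u : 'rV[R]_n) : smooth_row (fun=> u).
Proof. by move=> i; exact: smooth_cst. Qed.

Lemma smooth_row_sub u v : smooth_row u -> smooth_row v ->
  smooth_row (fun z => u z - v z).
Proof.
move=> su sv i; apply: (smooth_ext oO (f := fun z => u z 0 i - v z 0 i)).
  by move=> z _; rewrite !mxE.
exact: smooth_sub.
Qed.

Lemma smooth_row_opp u : smooth_row u -> smooth_row (fun z => - u z).
Proof.
move=> su i; apply: (smooth_ext oO (f := fun z => - u z 0 i)).
  by move=> z _; rewrite !mxE.
exact: smooth_opp.
Qed.

Lemma smooth_row_scale (c : V -> R) u : smooth_on O c -> smooth_row u ->
  smooth_row (fun z => c z *: u z).
Proof.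
move=> sc su i; apply: (smooth_ext oO (f := fun z => c z * u z 0 i)).
  by move=> z _; rewrite !mxE.
exact: smooth_mul.
Qed.

Lemma smooth_row_mul u M : smooth_row u ->
  (forall i j, smooth_on O (fun z => M z i j)) ->
  smooth_row (fun z => u z *m M z).
Proof.
move=> su sM i; apply: (smooth_ext oO (f := fun z => \sum_j u z 0 j * M z j i)).
  by move=> z _; rewrite !mxE.
by apply: smooth_sum => // j _; exact: smooth_mul.
Qed.

Lemma smooth_dot u v : smooth_row u -> smooth_row v ->
  smooth_on O (fun z => dot (u z) (v z)).
Proof.
move=> su sv; apply: (smooth_ext oO (f := fun z => \sum_j u z 0 j * v z 0 j)).
  by move=> z _; rewrite dotE.
by apply: smooth_sum => // j _; exact: smooth_mul.
Qed.

End smooth_rows.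

(** Matrix form of the sum defining J: [a], [b], [c] stand for g^ij, g_ij, N_ij, and [x], [y] for
    the position and vertical parts. *)
Lemma acs_sum (R : realType) (n : nat) (a b c : 'M[R]_n) (x y : 'rV[R]_n) :
  \sum_i x 0 i *: (- \sum_j b i j *: ((0, delta_mx 0 j) : phase R n))
  + \sum_i y 0 i *: (\sum_j a i j *: ((delta_mx 0 j, row j c) : phase R n))
  = (y *m a, y *m a *m c - x *m b).
Proof.
have rowE (d : 'M[R]_n) i : \sum_j d i j *: (delta_mx 0 j : 'rV[R]_n) = row i d.
  by rewrite [RHS]row_sum_delta; apply: eq_bigr => j _; rewrite mxE.
have Eb i : \sum_j b i j *: ((0, delta_mx 0 j) : phase R n) = (0, row i b).
  rewrite [LHS]surjective_pairing fst_sum snd_sum /= rowE big1 // => j _.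
  exact: scaler0.
have Ea i : \sum_j a i j *: ((delta_mx 0 j, row j c) : phase R n) =
    (row i a, row i a *m c).
  rewrite [LHS]surjective_pairing fst_sum snd_sum /= rowE mulmx_sum_row.
  by congr (_, _); apply: eq_bigr => j _; rewrite mxE.
under eq_bigr do rewrite Eb.
under [X in _ + X]eq_bigr do rewrite Ea.
rewrite [LHS]surjective_pairing /= !fst_sum !snd_sum /=.
rewrite big1 => [|i _]; last by rewrite oppr0 scaler0.
rewrite add0r; congr (_, _).
  by rewrite mulmx_sum_row.
rewrite addrC; congr (_ + _).
  rewrite [y *m a]mulmx_sum_row mulmx_suml; apply: eq_bigr => i _.
  by rewrite scalemxAl.
by rewrite mulmx_sum_row -sumrN; apply: eq_bigr => i _; rewrite scalerN.
Qed.

(** * Cartan functions on an open set of a coordinate space *)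

Section local_cartan.
Context (R : realType) (n : nat) (O : set (phase R n)) (F : phase R n -> R).
Hypotheses (oO : open O) (sF : smooth_on O F).
Hypothesis homF : forall z, O z -> forall l : R, 0 < l ->
  F (z.1, l *: z.2) = l * F z.
Hypothesis posF : forall z, O z -> forall v : 'rV[R]_n, v != 0 ->
  0 < \sum_i \sum_j g_up F z i j * v 0 i * v 0 j.
Implicit Types (z v w : phase R n).

Local Notation H := (sqrf F).
Local Notation A := (g_up F).
Local Notation B := (g_low F).
Local Notation N := (nlconn F).

Lemma g_upE z i j : A z i j = 2^-1 * d_p i (d_p j H) z.
Proof. by rewrite /g_up mxE. Qed.

Lemma nlconnE z i j : N z i j =
  4^-1 * poisson (fun y => B y i j) H z
  - 4^-1 * \sum_k (B z i k * d_p k (d_x j H) z + B z j k * d_p k (d_x i H) z).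
Proof. by rewrite /nlconn mxE. Qed.

Lemma g_lowE z : B z = invmx (A z).
Proof. by []. Qed.

Lemma smooth_d_x i (f : phase R n -> R) :
  smooth_on O f -> smooth_on O (d_x i f).
Proof. exact: smooth_derive. Qed.
Lemma smooth_d_p i (f : phase R n -> R) :
  smooth_on O f -> smooth_on O (d_p i f).
Proof. exact: smooth_derive. Qed.

Lemma d_p_d_p (f : phase R n -> R) i j z : smooth_on O f -> O z ->
  d_p i (d_p j f) z = d_p j (d_p i f) z.
Proof.
move=> sf Oz.
exact: (@smooth_clairaut _ _ O f (0, delta_mx 0 j) (0, delta_mx 0 i) z).
Qed.

Lemma d_p_d_x (f : phase R n -> R) i j z : smooth_on O f -> O z ->
  d_p i (d_x j f) z = d_x j (d_p i f) z.
Proof.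
move=> sf Oz.
exact: (@smooth_clairaut _ _ O f (delta_mx 0 j, 0) (0, delta_mx 0 i) z).
Qed.

Lemma d_xE i (f : phase R n -> R) z : 'D_(delta_mx 0 i, 0) f z = d_x i f z.
Proof. by []. Qed.
Lemma d_pE i (f : phase R n -> R) z : 'D_(0, delta_mx 0 i) f z = d_p i f z.
Proof. by []. Qed.

Opaque d_x d_p g_up g_low nlconn.

Lemma smooth_mom_coord i : smooth_on O (@mom_coord R n i).
Proof. exact/smooth_linear/mom_coord_cont. Qed.

Lemma derive_mom_coord i z w : 'D_w (@mom_coord R n i) z = w.2 0 i.
Proof.
have cm := @mom_coord_cont R n i.
by rewrite (deriveE w (linear_differentiable z cm)) (diff_lin z cm).
Qed.

(** * Euler identities for [K] and its square *)

Lemma smooth_sqrf : smooth_on O H.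
Proof.
by apply: smooth_ext (smooth_mul oO sF sF) => // z _; rewrite /sqrf expr2.
Qed.

(** Moving by [h] along the ray multiplies [F] by [1 + h], so the difference quotient is constantly
    [F z] near 0. *)
Lemma euler z : O z -> 'D_((0, z.2) : phase R n) F z = F z.
Proof.
move=> Oz; apply/cvg_lim => //.
apply: (@cvg_trans _ (cst (F z) @ (0 : R)^')); last exact: cvg_cst.
apply: near_eq_cvg; near=> h.
have h0 : h != 0 by near: h; exact: nbhs_dnbhs_neq.
(* Homogeneity is available for positive factors only, hence the restriction to [|h| < 1]. *)
have h1 : 0 < 1 + h.
  rewrite -ltrBlDl sub0r; suff : `|h| < 1 by rewrite ltr_norml => /andP[].
  by near: h; apply: dnbhs0_lt.
have -> : (F \o shift z) (h *: ((0, z.2) : phase R n)) =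
    F (z.1, (1 + h) *: z.2).
  rewrite /=; congr F; rewrite [LHS]surjective_pairing /= scaler0 add0r.
  by rewrite scalerDl scale1r addrC.
rewrite homF // mulrDl mul1r addrAC subrr add0r.
by rewrite [_ *: _]mulKf.
Unshelve. all: by end_near. Qed.

Lemma derive_sqrf z v : O z -> 'D_v H z = 2 * F z * 'D_v F z.
Proof.
move=> Oz; have dF : derivable F z v by exact: smooth_derivable sF Oz.
have -> : H = F * F by apply/funext => y; rewrite /sqrf expr2.
rewrite deriveM //; rewrite [_ *: _]mulrC; ring.
Qed.

Lemma euler_sqrf z : O z -> \sum_j z.2 0 j * d_p j H z = 2 * H z.
Proof.
move=> Oz; have dH := smooth_diff smooth_sqrf Oz.
have := derive_phase ((0, z.2) : phase R n) dH.
rewrite derive_sqrf // euler //= => E.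
transitivity (2 * F z * F z); last by rewrite /sqrf; ring.
rewrite E [X in _ = X + _]big1 ?add0r // => i _; by rewrite mxE mul0r.
Qed.

(** Euler's relation p_j d^j K^2 = 2 K^2 holds on an open set, so it can be differentiated in any
    direction; the coordinate directions give the next two lemmas. *)
Lemma euler_derive z w : O z ->
  \sum_j z.2 0 j * 'D_w (d_p j H) z =
  2 * 'D_w H z - \sum_j w.2 0 j * d_p j H z.
Proof.
move=> Oz; have sH := smooth_sqrf.
have dH := smooth_diff sH Oz.
have E : 'D_w (fun y => \sum_j mom_coord j y * d_p j H y) z = 2 * 'D_w H z.
  rewrite (@near_eq_derive _ _ _ _ (2 *: H)).
    by rewrite deriveZ //; exact: diff_derivable.
  by apply: (open_near oO Oz) => y Oy; exact: euler_sqrf.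
rewrite derive_sum_mul in E.
- rewrite -E big_split /= [X in X + _ - _](_ : _ = \sum_j w.2 0 j * d_p j H z).
    by rewrite addrAC subrr add0r.
  by apply: eq_bigr => j _; congr (_ * _); exact: derive_mom_coord.
- by move=> i; apply: smooth_diff (smooth_mom_coord i) Oz.
- by move=> i; apply: smooth_diff (smooth_d_p i sH) Oz.
Qed.

Lemma euler_d_p z j : O z -> \sum_k z.2 0 k * d_p j (d_p k H) z = d_p j H z.
Proof.
move=> Oz; have := euler_derive ((0, delta_mx 0 j) : phase R n) Oz => /=.
rewrite d_pE; under eq_bigr do rewrite d_pE.
(* The subtracted sum collapses to its [j] term, which removes one of the two copies of d^j K^2. *)
move=> ->; rewrite (bigD1 j) //= mxE !eqxx mul1r big1 => [|k kj].
  by rewrite addr0 mulr_natl mulr2n addrK.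
by rewrite mxE (negbTE kj) mul0r.
Qed.

Lemma euler_d_x z i : O z -> \sum_k z.2 0 k * d_x i (d_p k H) z = 2 * d_x i H z.
Proof.
move=> Oz; have := euler_derive ((delta_mx 0 i, 0) : phase R n) Oz => /=.
rewrite d_xE; under eq_bigr do rewrite d_xE.
by move=> ->; rewrite big1 ?subr0 // => j _; rewrite mxE mul0r.
Qed.

(** * The metric tensor, its inverse and the nonlinear connection *)

Lemma g_up_sym z : O z -> (A z)^T = A z.
Proof.
move=> Oz; apply/matrixP => i j.
by rewrite mxE !g_upE (d_p_d_p j i smooth_sqrf Oz).
Qed.

Definition raised z : 'rV[R]_n := z.2 *m A z.

Lemma raisedE z j : O z -> raised z 0 j = 2^-1 * d_p j H z.
Proof.
move=> Oz; rewrite /raised mxE -(euler_d_p j Oz) mulr_sumr.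
by apply: eq_bigr => k _; rewrite g_upE mulrCA (d_p_d_p k j smooth_sqrf Oz).
Qed.

Lemma d_p_raised z j : O z -> d_p j H z = 2 * raised z 0 j.
Proof. by move=> Oz; rewrite raisedE // mulrA divff ?mul1r // pnatr_eq0. Qed.

Lemma pos_g_up z (v : 'rV[R]_n) : O z -> v != 0 -> 0 < (v *m A z *m v^T) 0 0.
Proof.
move=> Oz v0; have := posF Oz v0; congr (_ < _).
rewrite mxE exchange_big; apply: eq_bigr => j _ /=.
rewrite !mxE mulr_suml; apply: eq_bigr => i _.
rewrite mulrAC [in RHS]mulrC; ring.
Qed.

(** A nonzero row in the kernel would make the positive form vanish. *)
Lemma g_up_unit z : O z -> A z \in unitmx.
Proof.
move=> Oz; rewrite unitmxE unitfE; apply/det0P => -[v v0 vA].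
by have := pos_g_up Oz v0; rewrite vA mul0mx mxE ltxx.
Qed.

Lemma g_low_sym z : O z -> (B z)^T = B z.
Proof. by move=> Oz; rewrite g_lowE trmx_inv g_up_sym. Qed.

Lemma g_low_symE i j z : O z -> B z i j = B z j i.
Proof. by move=> Oz; rewrite -{1}(g_low_sym Oz) mxE. Qed.

Lemma smooth_g_up i j : smooth_on O (fun z => A z i j).
Proof.
apply: (smooth_ext oO (f := fun z => 2^-1 * d_p i (d_p j H) z)).
  by move=> z _; rewrite g_upE.
apply: smooth_mul => //; first exact: smooth_cst.
exact/smooth_d_p/smooth_d_p/smooth_sqrf.
Qed.

Lemma smooth_g_low i j : smooth_on O (fun z => B z i j).
Proof.
(* Cramer's rule: the entries of the inverse are cofactors over a determinant that does not vanish
   on [O]. *)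
apply: (smooth_ext oO (f := fun z => (\det (A z))^-1 *
    ((-1) ^+ (j + i) * \det (row' j (col' i (A z)))))).
  by move=> z Oz; rewrite g_lowE /invmx g_up_unit // !mxE /cofactor.
apply: smooth_mul => //.
  apply: smooth_inv => //; first by
    apply: smooth_det => // k l; exact: smooth_g_up.
  by move=> z Oz; rewrite -unitfE -unitmxE g_up_unit.
apply: smooth_mul => //; first exact: smooth_cst.
apply: smooth_det => // k l.
apply: (smooth_ext oO (f := fun z => A z (lift j k) (lift i l))).
  by move=> z _; rewrite !mxE.
exact: smooth_g_up.
Qed.

Lemma smooth_poisson (f h : phase R n -> R) :
  smooth_on O f -> smooth_on O h -> smooth_on O (poisson f h).
Proof.
move=> sf sh; apply: smooth_sum => // i _.
apply: smooth_sub => //; apply: smooth_mul => //.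
- exact: smooth_d_p.
- exact: smooth_d_x.
- exact: smooth_d_p.
- exact: smooth_d_x.
Qed.

Lemma smooth_nlconn i j : smooth_on O (fun z => N z i j).
Proof.
have sH := smooth_sqrf.
apply: (smooth_ext oO (f := fun z =>
  4^-1 * poisson (fun y => B y i j) H z
  - 4^-1 * \sum_k (B z i k * d_p k (d_x j H) z + B z j k * d_p k (d_x i H) z))).
  by move=> z _; rewrite nlconnE.
apply: smooth_sub => //; (apply: smooth_mul => //; first exact: smooth_cst).
  by apply: smooth_poisson => //; exact: smooth_g_low.
apply: smooth_sum => // k _; apply: smooth_add => //; apply: smooth_mul => //;
  by [exact: smooth_g_low | apply: smooth_d_p; exact: smooth_d_x].
Qed.

Lemma nlconn_sym z : O z -> (N z)^T = N z.
Proof.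
move=> Oz; apply/matrixP => i j.
(* The bracket differentiates g_ij, so its symmetry is needed on a neighbourhood and not just at
   [z]. *)
have E : \near z, B z j i = B z i j.
  by apply: (open_near oO Oz) => y Oy; rewrite (g_low_symE j i Oy).
have P : poisson (fun y => B y j i) H z = poisson (fun y => B y i j) H z.
  apply: eq_bigr => k _.
  by rewrite -!d_pE -!d_xE !(near_eq_derive _ E).
rewrite mxE (nlconnE z j i) (nlconnE z i j) P.
apply: (congr1 (fun s : R =>
    4^-1 * poisson (fun y => B y i j) H z - 4^-1 * s)).
by apply: eq_bigr => k _; exact: addrC.
Qed.

(** * Constancy of [K] along the horizontal distribution *)

Lemma lower_raised z i : O z -> \sum_j B z i j * raised z 0 j = z.2 0 i.
Proof.
move=> Oz; have : raised z *m B z = z.2 by rewrite /raised mulmxK // g_up_unit.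
move=> /(congr1 (fun u : 'rV[R]_n => u 0 i)); rewrite mxE => <-.
by apply: eq_bigr => j _; rewrite mulrC (g_low_symE j i Oz).
Qed.

Lemma derive_g_low_raised z i w : O z ->
  \sum_j 'D_w (fun y => B y i j) z * raised z 0 j =
  w.2 0 i - \sum_j B z i j * (2^-1 * 'D_w (d_p j H) z).
Proof.
move=> Oz; have sH := smooth_sqrf.
have s2 j : smooth_on O (2^-1 *: d_p j H).
  apply: smooth_mul => //; first exact: smooth_cst.
  exact: smooth_d_p.
(* This differentiates g_ij p^j = p_i, with p^j written as half of d^j K^2 so that its derivative is
   explicit. *)
have E : 'D_w (fun y => \sum_j B y i j * (2^-1 *: d_p j H) y) z = w.2 0 i.
  rewrite -(derive_mom_coord i z w); apply: near_eq_derive.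
  apply: (open_near oO Oz) => y Oy; rewrite -[RHS](lower_raised i Oy).
  by apply: eq_bigr => j _; rewrite raisedE.
rewrite derive_sum_mul in E.
- rewrite -E big_split /= -addrA [X in _ + X](_ : _ = 0).
    by rewrite addr0; apply: eq_bigr => j _; rewrite raisedE.
  apply/eqP; rewrite subr_eq0; apply/eqP; apply: eq_bigr => j _.
  by rewrite deriveZ //; apply: smooth_derivable (smooth_d_p j sH) Oz.
- by move=> j; apply: smooth_diff (smooth_g_low i j) Oz.
- by move=> j; apply: smooth_diff (s2 j) Oz.
Qed.

Lemma d_p_g_low_raised z i k : O z ->
  \sum_j d_p k (fun y => B y i j) z * raised z 0 j = 0.
Proof.
move=> Oz; have := derive_g_low_raised i (0, delta_mx 0 k) Oz.
under eq_bigr do rewrite d_pE; move=> -> /=.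
(* The sum is g_ij g^jk, an entry of the identity matrix, and cancels the derivative of p_i. *)
have -> : \sum_j B z i j * (2^-1 * 'D_(0, delta_mx 0 k) (d_p j H) z) =
    (B z *m A z) i k.
  rewrite mxE; apply: eq_bigr => j _.
  by rewrite d_pE (g_upE z j k) (d_p_d_p k j smooth_sqrf Oz).
by rewrite g_lowE mulVmx ?g_up_unit // !mxE eq_sym subrr.
Qed.

Lemma d_x_g_low_raised z i k : O z ->
  \sum_j d_x k (fun y => B y i j) z * raised z 0 j =
  - \sum_j B z i j * (2^-1 * d_x k (d_p j H) z).
Proof.
move=> Oz; have := derive_g_low_raised i (delta_mx 0 k, 0) Oz.
under eq_bigr do rewrite d_xE; move=> ->.
by rewrite mxE sub0r; under eq_bigr do rewrite d_xE.
Qed.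

Lemma horizontal_sqrf z i : O z ->
  d_x i H z + \sum_j N z i j * d_p j H z = 0.
Proof.
move=> Oz; have sH := smooth_sqrf.
apply: (@horizontal_contraction _ _ (fun j => N z i j) (fun k => B z i k)
  (fun j => raised z 0 j) (fun j => d_p j H z) (fun k => d_x k H z)
  (fun k => d_p k (d_x i H) z) (fun k j => d_p k (fun y => B y i j) z)
  (fun k j => d_x k (fun y => B y i j) z) (fun k j => d_x k (d_p j H) z)
  (fun j k => B z j k)).
- move=> j; rewrite nlconnE.
  apply: (congr1 (fun s : R =>
    4^-1 * poisson (fun y => B y i j) H z - 4^-1 * s)).
  apply: eq_bigr => k _.
  by apply: (congr1 (fun s : R => B z i k * s + B z j k * d_p k (d_x i H) z));
    exact: d_p_d_x.
- by move=> k; exact: d_p_g_low_raised.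
- by move=> k; exact: d_x_g_low_raised.
- by move=> k; exact: d_p_raised.
(* Lowering p^j gives back p_k, and what remains is Euler's identity for the position derivative. *)
- rewrite -(euler_d_x i Oz); apply: eq_bigr => k _.
  rewrite -(lower_raised k Oz) (d_p_d_x k i sH Oz).
  apply: (congr1 (fun s : R => s * d_x i (d_p k H) z)).
  by apply: eq_bigr => j _; rewrite (g_low_symE j k Oz).
Qed.

(** * The structure tensors in matrix form *)

Hypothesis posK : forall z, O z -> 0 < F z.

Lemma g_up_low z : O z -> A z *m B z = 1%:M.
Proof. by move=> Oz; rewrite g_lowE mulmxV // g_up_unit. Qed.

(** [deltap] contracts the second index of N_ij and [vert] the first; symmetry of N_ij reconciles
    them. *)
Lemma deltap_vert z i v : O z -> deltap F z i v = vert (N z) v 0 i.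
Proof.
move=> Oz; rewrite /deltap /vert mxE [(- _ : 'rV_n) 0 i]mxE mxE.
apply: (congr1 (fun s : R => v.2 0 i - s)); apply: eq_bigr => j _.
by rewrite -{1}(nlconn_sym Oz) mxE mulrC.
Qed.

Lemma acs_mxJ z : O z -> acs F z = mxJ (A z) (B z) (N z).
Proof.
move=> Oz; apply/funext => v; rewrite /mxJ -acs_sum /acs.
congr (_ + _); apply: eq_bigr => i _.
by rewrite deltap_vert.
Qed.

Lemma sasaki_mxG z : O z -> sasaki F z = mxG (A z) (B z) (N z).
Proof.
move=> Oz; apply/funext => v; apply/funext => w; rewrite /sasaki /mxG.
have quad (C : 'M[R]_n) (x y : 'rV[R]_n) :
    \sum_i \sum_j C i j * x 0 i * y 0 j = dot (x *m C) y.
  rewrite exchange_big dotE; apply: eq_bigr => j _ /=.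
  by rewrite mxE mulr_suml; apply: eq_bigr => i _; rewrite [C i j * _]mulrC.
rewrite -!quad; apply: congr1.
apply: eq_bigr => i _; apply: eq_bigr => j _.
by rewrite !deltap_vert.
Qed.

Lemma reeb_mxXi z : O z -> reeb F z = mxXi (A z) (N z) z.2.
Proof.
move=> Oz; rewrite /reeb acs_mxJ // /mxJ /mxXi /vert
  /liouville_field /=.
by rewrite !mul0mx !subr0.
Qed.

Lemma phi_contact_endo z : O z ->
  phi F z = contact_endo (A z) (B z) (N z) z.2.
Proof.
move=> Oz; rewrite /phi /contact_endo.
by rewrite (acs_mxJ Oz) (sasaki_mxG Oz) (reeb_mxXi Oz).
Qed.

Lemma liouville_form_dot z v : liouville_form z v = dot z.2 v.1.
Proof. by rewrite dotE. Qed.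

(** Where [F] is 1 the differential of its square is twice its own, and the square varies only
    through the vertical component; tangency thus becomes c_i p^i = 0. *)
Lemma derive_vert z v : O z -> F z = 1 ->
  'D_v F z = dot (vert (N z) v) (z.2 *m A z).
Proof.
move=> Oz F1; have E := derive_sqrf v Oz.
have := derive_phase v (smooth_diff smooth_sqrf Oz).
rewrite E F1 mulr1.
have -> := sum_horizontal v (fun i => horizontal_sqrf i Oz) (q := raised z).
  by apply: mulfI; rewrite pnatr_eq0.
by move=> j; rewrite raisedE // mulrA divff ?mul1r // pnatr_eq0.
Qed.

Lemma dot_raised z : O z -> dot z.2 (z.2 *m A z) = F z ^+ 2.
Proof.
move=> Oz; rewrite dotE.
have h2 : (2 : R) != 0 by rewrite pnatr_eq0.
apply: (mulfI h2); rewrite -[RHS](euler_sqrf Oz) mulr_sumr.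
apply: eq_bigr => j _.
by rewrite (d_p_raised j Oz) mulrCA.
Qed.

(** * Smoothness of the structure tensors *)

Lemma smooth_vert (w : phase R n -> phase R n) :
  smooth_row O (fun z => (w z).1) -> smooth_row O (fun z => (w z).2) ->
  smooth_row O (fun z => vert (N z) (w z)).
Proof.
move=> s1 s2; apply: smooth_row_sub => //.
by apply: smooth_row_mul => //; exact: smooth_nlconn.
Qed.

Lemma smooth_mxJ (w : phase R n -> phase R n) :
  smooth_row O (fun z => (w z).1) -> smooth_row O (fun z => (w z).2) ->
  smooth_row O (fun z => (mxJ (A z) (B z) (N z) (w z)).1) /\
  smooth_row O (fun z => (mxJ (A z) (B z) (N z) (w z)).2).
Proof.
move=> s1 s2; have sv := smooth_vert s1 s2.
have sA := smooth_row_mul oO sv smooth_g_up; split=> //.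
apply: smooth_row_sub => //; apply: smooth_row_mul => //.
  exact: smooth_nlconn.
exact: smooth_g_low.
Qed.

Lemma smooth_mxG (v w : phase R n -> phase R n) :
  smooth_row O (fun z => (v z).1) -> smooth_row O (fun z => (v z).2) ->
  smooth_row O (fun z => (w z).1) -> smooth_row O (fun z => (w z).2) ->
  smooth_on O (fun z => mxG (A z) (B z) (N z) (v z) (w z)).
Proof.
move=> v1 v2 w1 w2; apply: smooth_add => //; apply: smooth_dot => //.
- by apply: smooth_row_mul => //; exact: smooth_g_low.
- by apply: smooth_row_mul => //; [exact: smooth_vert|exact: smooth_g_up].
- exact: smooth_vert.
Qed.

Lemma smooth_mxXi :
  smooth_row O (fun z => (mxXi (A z) (N z) z.2).1) /\
  smooth_row O (fun z => (mxXi (A z) (N z) z.2).2).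
Proof.
have s1 : smooth_row O (fun z => z.2 *m A z).
  by apply: smooth_row_mul => //; [exact: smooth_mom_coord|exact: smooth_g_up].
by split=> //; apply: smooth_row_mul => //; exact: smooth_nlconn.
Qed.

Lemma mxG_mxXi_mxXi z : O z ->
  mxG (A z) (B z) (N z) (mxXi (A z) (N z) z.2) (mxXi (A z) (N z) z.2)
  = F z ^+ 2.
Proof.
move=> Oz; rewrite mxG_mxXi ?g_low_sym ?g_up_low //; exact: dot_raised.
Qed.

Lemma smooth_contact_endo v :
  smooth_on O (fun z => contact_endo (A z) (B z) (N z) z.2 v).
Proof.
have [d1 d2] := smooth_mxXi.
have c1 := smooth_row_cst oO v.1; have c2 := smooth_row_cst oO v.2.
have sm : smooth_on O (fun z =>
    mxG (A z) (B z) (N z) v (mxXi (A z) (N z) z.2) /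
    mxG (A z) (B z) (N z) (mxXi (A z) (N z) z.2) (mxXi (A z) (N z) z.2)).
  apply: smooth_mul => //; first exact: smooth_mxG.
  apply: smooth_inv => //; first exact: smooth_mxG.
  (* The denominator is K^2, nonzero on all of [O] and not only on the indicatrix. *)
  by move=> z Oz; rewrite mxG_mxXi_mxXi // expf_neq0 // gt_eqF // posK.
pose w z := v - (mxG (A z) (B z) (N z) v (mxXi (A z) (N z) z.2) /
    mxG (A z) (B z) (N z) (mxXi (A z) (N z) z.2) (mxXi (A z) (N z) z.2))
    *: mxXi (A z) (N z) z.2.
have [r1 r2] := @smooth_mxJ w
  (smooth_row_sub oO c1 (smooth_row_scale oO sm d1))
  (smooth_row_sub oO c2 (smooth_row_scale oO sm d2)).
apply: smooth_phase => //; exact: smooth_row_opp.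
Qed.

(** The Liouville form is linear in the momenta, so each term splits by Leibniz' rule into a
    momentum part and a derivative of the field; the latter derivatives cancel against the
    bracket. *)
Lemma ext_d_liouville (U : set (phase R n)) (X Y : phase R n -> phase R n) z :
  open U -> smooth_on U X -> smooth_on U Y -> U z ->
  ext_d (@liouville_form R n) X Y z
  = dot (X z).2 (Y z).1 - dot (Y z).2 (X z).1.
Proof.
move=> oU sX sY Uz.
have D (W : phase R n -> phase R n) v : smooth_on U W ->
    'D_v (fun y => liouville_form y (W y)) z
    = dot v.2 (W z).1 + dot z.2 ('D_v W z).1.
  move=> sW; have dW := smooth_diff sW Uz.
  have dpos i := linear_comp_derive v (@pos_coord_cont R n i) dW.
  have := @derive_sum_mul R _ n (@mom_coord R n)
    (fun i y => pos_coord i (W y)) z v.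
  rewrite /= => ->.
  - rewrite big_split /= !dotE; congr (_ + _); apply: eq_bigr => i _.
      by rewrite derive_mom_coord.
    by have [_ ->] := dpos i.
  - move=> i; apply: linear_differentiable; exact: mom_coord_cont.
  - by move=> i; have [] := dpos i.
rewrite /ext_d (D Y (X z) sY) (D X (Y z) sX) liouville_form_dot dotDr dotNr.
have alg (a b c d : R) : a + c - (b + d) - (c - d) = a - b by ring.
exact: alg.
Qed.

Lemma local_contact (S : set (phase R n)) :
  O `&` S = O `&` [set z | F z = 1] ->
  contact_metric_hypersurface O S F 1
    (phi F) (@liouville_form R n) (reeb F) (sasaki F).
Proof.
move=> OS.
have F1 z : O z -> S z -> F z = 1.
  by move=> Oz Sz; have [] : (O `&` [set z | F z = 1]) z by rewrite -OS.
have tanP z v : O z -> S z -> tangent F z v ->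
    dot (vert (N z) v) (z.2 *m A z) = 0.
  by move=> Oz Sz; rewrite /tangent /= derive_vert // F1.
have tanI z v : O z -> S z -> dot (vert (N z) v) (z.2 *m A z) = 0 ->
    tangent F z v.
  by move=> Oz Sz; rewrite /tangent /= derive_vert // F1.
have pA1 z : O z -> S z -> dot z.2 (z.2 *m A z) = 1.
  by move=> Oz Sz; rewrite dot_raised // F1 // expr1n.
split.
- exact: oO.
- exact: OS.
- exact: sF.
(* The radial direction is transverse: by Euler the derivative of [F] along it is [F] itself. *)
- move=> z Oz Sz; exists (0, z.2); rewrite euler // gt_eqF //; exact: posK.
- move=> v; apply: (smooth_ext oO) (smooth_contact_endo v) => z Oz.
  by rewrite phi_contact_endo.
- move=> v; apply: (smooth_ext oO (f := fun z => dot z.2 v.1)).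
    by move=> z _; rewrite liouville_form_dot.
  by apply: smooth_dot => //; [exact: smooth_mom_coord|exact: smooth_row_cst].
- have [d1 d2] := smooth_mxXi.
  apply: (smooth_ext oO (f := fun z => mxXi (A z) (N z) z.2)).
    by move=> z Oz; rewrite reeb_mxXi.
  exact: smooth_phase.
- move=> v w.
  apply: (smooth_ext oO (f := fun z => mxG (A z) (B z) (N z) v w)).
    by move=> z Oz; rewrite sasaki_mxG.
  by apply: smooth_mxG; exact: smooth_row_cst.
- move=> z Oz Sz v /(tanP z v Oz Sz) tv; apply: tanI => //.
  rewrite phi_contact_endo //.
  by apply: contact_endo_tangent; rewrite ?g_up_sym ?g_low_sym ?g_up_low ?pA1.
- move=> z Oz Sz k v w _ _; rewrite phi_contact_endo //.
  by apply: contact_endoP; rewrite ?g_up_sym ?g_low_sym ?g_up_low ?pA1.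
- move=> z Oz Sz k v w _ _; rewrite !liouville_form_dot.
  by rewrite /= dotDr dotZr.
- move=> z Oz Sz; apply: tanI => //.
  by rewrite reeb_mxXi // vert_mxXi dot0l.
- move=> z Oz Sz k v v' w _ _ _; rewrite sasaki_mxG //; exact: mxGP.
- move=> z Oz Sz v w _ _; rewrite sasaki_mxG //.
  by apply: mxGC; [exact: g_up_sym|exact: g_low_sym].
- move=> z Oz Sz v _ v0; rewrite sasaki_mxG //.
  apply: mxG_gt0 => //; first by rewrite g_up_low.
  by move=> u; exact: pos_g_up.
- move=> z Oz Sz; rewrite reeb_mxXi // liouville_form_dot; exact: pA1.
- move=> z Oz Sz v /(tanP z v Oz Sz) tv; rewrite phi_contact_endo //.
  rewrite liouville_form_dot.
  by apply: dot_contact_endo; rewrite ?g_up_sym ?g_low_sym ?g_up_low ?pA1.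
- move=> z Oz Sz; rewrite phi_contact_endo // reeb_mxXi //.
  by apply: contact_endo_mxXi; rewrite ?g_up_sym ?g_low_sym ?g_up_low ?pA1.
- move=> z Oz Sz v /(tanP z v Oz Sz) tv; rewrite phi_contact_endo //.
  rewrite reeb_mxXi // liouville_form_dot.
  by apply: contact_endo2; rewrite ?g_up_sym ?g_low_sym ?g_up_low ?pA1.
- move=> z Oz Sz v w /(tanP z v Oz Sz) tv /(tanP z w Oz Sz) tw.
  rewrite phi_contact_endo // sasaki_mxG // !liouville_form_dot.
  by apply: mxG_contact_endo; rewrite ?g_up_sym ?g_low_sym ?g_up_low ?pA1.
- move=> U X Y oU UO sX sY tXY z Uz Sz; have Oz := UO z Uz.
  have [tX _] := tXY z Uz Sz.
  rewrite (ext_d_liouville oU sX sY Uz) phi_contact_endo // sasaki_mxG //.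
  rewrite mxG_endo ?g_up_sym ?g_low_sym ?g_up_low ?pA1 //; last exact: tanP.
  (* Momentum coordinates and vertical components differ by [N]-images of the position parts; these
     contributions cancel by symmetry of [N]. *)
  rewrite /vert !dotDl !dotNl (dot_sym _ _ (nlconn_sym Oz)).
  rewrite (dotC (X z).1); move: (dot _ _) (dot _ _) (dot _ _) => a b c.
  ring.
Qed.

End local_cartan.

(** * Application to the charts of the atlas *)

Theorem theorem5p1 (R : realType) (n : nat) (M : smooth_manifold R n)
    (K : cotangent_bundle M -> R) (cartanK : cartan_space K) :
  forall a : chart R n M, atlas a ->
    contact_metric_hypersurface
      (slit_domain a)
      (uncoord a @^-1` indicatrix_bundle K)%classic
      (local_expr K a) 1%R
      (phi (local_expr K a)) (@liouville_form R n)
      (reeb (local_expr K a)) (sasaki (local_expr K a)).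
Proof.
move=> a aa; apply: local_contact.
(* Openness: the domain is an intersection of preimages of open sets under the two projections. *)
- have -> : slit_domain a = (fst @^-1` chart_img a) `&` (snd @^-1` ~` [set 0]).
    by apply/seteqP; split=> z [iz /eqP z0].
  apply: openI; apply: open_comp.
  + by move=> z _; exact: cvg_fst.
  + exact: chart_open_img.
  + by move=> z _; exact: cvg_snd.
  + apply: closed_openC; apply: accessible_closed_set1.
    by apply: hausdorff_accessible; exact: norm_hausdorff.
- exact: cartan_smooth.
- by move=> z [iz _] l l0; exact: cartan_homog.
- by move=> z Oz v v0; exact: cartan_posdef.
- by move=> z Oz; exact: cartan_pos.
(* [local_expr K a] is [K \o uncoord a], so the preimage of the indicatrix bundle is by definition
   its level set at 1. *)
- by [].
Qed.
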